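(* Let $G$ be a graph on the vertex set $\{1,\dots,n\}$ whose adjacency matrix $\Gamma$ is nonsingular over $\mathbb{F}_2$. Then $\Gamma^{-1}$ (the inverse over $\mathbb{F}_2$) is the adjacency matrix of a graph that is edge-locally equivalent to $G$; that is, $\Gamma^{-1}$ can be obtained from $\Gamma$ by performing a sequence of edge-local complementations on the corresponding graph.
   Context: Graphs are finite, undirected and simple with vertex set $V=\{1,\dots,n\}$; an adjacency matrix is a symmetric matrix over $\mathbb{F}_2$ with zero diagonal. Local complementation: for a vertex $i$, $G*i$ is the graph on $V$ obtained from $G$ by replacing the subgraph induced on the neighborhood $N(i)$ by its complement and leaving the rest unchanged. For an edge $e=\{i,j\}$ of $G$, the edge-local complement is $G*e=((G*i)*j)*i=((G*j)*i)*j$. Two graphs $G,G'$ on $V$ are edge-locally equivalent if there is a finite (possibly empty) sequence $e_1,\dots,e_N$ of 2-element subsets of $V$ such that $e_1$ is an edge of $G$, $e_\alpha$ is an edge of $((G*e_1)*\dots)*e_{\alpha-1}$ for $\alpha=2,\dots,N$, and $((G*e_1)*\dots)*e_N=G'$. *)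

(* Defs.v *)
From HB Require Import structures.
From mathcomp Require Import all_boot all_order all_algebra.

Set Implicit Arguments.
Unset Strict Implicit.
Unset Printing Implicit Defensive.

Import GRing.Theory.

(* The vertices 1, ..., n are represented by the ordinals 0, ..., n-1.  The
   well-formedness condition is boolean, hence two graphs are equal as soon as
   they have the same edge set. *)
Record graph (n : nat) := Graph {
  edges : {set {set 'I_n}};
  edges_card : [forall e in edges, #|e| == 2] }.

HB.instance Definition _ n := [isSub for @edges n].

Section Graphs.
Variable n : nat.
Implicit Types (G : graph n) (i j x y : 'I_n) (e : {set 'I_n}).

Definition neigh G i : {set 'I_n} := [set j | [set i; j] \in edges G].

(* The diagonal is zero because [set i; i] is a singleton, hence not an edge. *)
Definition adjmx G : 'M['F_2]_n :=
  (\matrix_(i, j) ([set i; j] \in edges G)%:R)%R.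

Definition lc_edges G i : {set {set 'I_n}} :=
  [set e : {set 'I_n} | (#|e| == 2) &&
     (if e \subset neigh G i then e \notin edges G else e \in edges G)].

Lemma lc_edges_card G i : [forall e in lc_edges G i, #|e| == 2].
Proof. by apply/forall_inP => e; rewrite inE => /andP[]. Qed.

Definition lc G i : graph n := Graph (lc_edges_card G i).

Definition elc G i j : graph n := lc (lc (lc G i) j) i.

(* elc_seq G s G' : the members of s are successively edges of the current
   graph, and complementing along them leads from G to G'.  The order in which
   the ends of an edge are named is irrelevant by elcC below. *)
Fixpoint elc_seq G (s : seq {set 'I_n}) (G' : graph n) : Prop :=
  if s is e :: s' then
    exists i j, [/\ e = [set i; j], e \in edges G & elc_seq (elc G i j) s' G']
  else G = G'.

Definition edge_locally_equivalent G G' : Prop := exists s, elc_seq G s G'.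

Let adj G x y := [set x; y] \in edges G.

Let adjC G x y : adj G x y = adj G y x.
Proof. by rewrite /adj setUC. Qed.

Let adjxx G x : adj G x x = false.
Proof.
apply/negP => xx; have /forall_inP/(_ _ xx) := edges_card G.
by rewrite cards2 eqxx.
Qed.

Let adj_lc G i x y :
  adj (lc G i) x y = adj G x y (+) [&& x != y, adj G i x & adj G i y].
Proof.
rewrite {1}/adj /= inE cards2 subUset !sub1set !inE -!/(adj _ _ _).
by have [<-|_] := eqVneq x y; rewrite ?adjxx //=; case: ifP => // _;
   rewrite ?addbT ?addbF.
Qed.

Let graph_ext G H : adj G =2 adj H -> G = H.
Proof.
move=> eqGH; apply/val_inj/setP => e /=.
have [/cards2P[x [y [_ ->]]]|eN2] := boolP (#|e| == 2); first exact: eqGH.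
have notin K : (e \in edges K) = false.
  by apply: contraNF eN2 => eK; apply: (forall_inP (edges_card K)).
by rewrite (notin G) (notin H).
Qed.

Lemma elcC G i j : [set i; j] \in edges G -> elc G i j = elc G j i.
Proof.
move=> ij; have {}ij : adj G i j by [].
have ji : adj G j i by rewrite adjC.
apply: graph_ext => x y; rewrite /elc !adj_lc.
have [->|xNy] := eqVneq x y; first by rewrite !adjxx.
rewrite /= !(adjxx, eqxx, ij, ji) /=.
have iNj : i != j by apply: contraTneq ij => ->; rewrite adjxx.
have jNi : j != i by rewrite eq_sym.
have [exi|nxi] := eqVneq i x; have [exj|nxj] := eqVneq j x;
have [eyi|nyi] := eqVneq i y; have [eyj|nyj] := eqVneq j y; subst;
  rewrite ?eqxx ?adjxx ?ij ?ji ?(negbTE iNj) ?(negbTE jNi) //= in iNj jNi xNy *;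
  rewrite ?(eqxx, adjxx, ij, ji, iNj, jNi, nxi, nxj, nyi, nyj) /=;
  rewrite ?(adjC _ y x) ?andbF ?andbT /=;
  by repeat match goal with
     | |- context [adj ?K ?a ?b] => case: (adj K a b)
     end.
Qed.

End Graphs.

(* Main.v *)
Require Import Defs.
From mathcomp Require Import all_boot all_order all_algebra.
From mathcomp Require Import ring.

(** Edge-local complementation along [ij] is the principal pivot transform of
    the adjacency matrix on [{i, j}]: it exchanges the coordinates [i] and [j]
    of [x] and [y] in the linear relation [y = A x].  The inverse matrix arises
    by exchanging all the coordinates.  If a matrix arises from the adjacency
    matrix of [G] by exchanging the coordinates in a nonempty set [X], then
    every vertex of [X] has a neighbour in [X]; pivoting on such an edge leaves
    two coordinates fewer to exchange. *)

Set Implicit Arguments.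
Unset Strict Implicit.
Unset Printing Implicit Defensive.

Import GRing.Theory.
Local Open Scope ring_scope.

Definition adj n (G : graph n) (x y : 'I_n) : bool := [set x; y] \in edges G.

Lemma adjC n (G : graph n) x y : adj G x y = adj G y x.
Proof. by rewrite /adj setUC. Qed.

Lemma adjxx n (G : graph n) x : adj G x x = false.
Proof.
apply/negP => xx; have /forall_inP/(_ _ xx) := edges_card G.
by rewrite cards2 eqxx.
Qed.

Lemma adjmxE n (G : graph n) x y : adjmx G x y = (adj G x y)%:R.
Proof. by rewrite mxE. Qed.

Lemma adj_lc n (G : graph n) i x y :
  adj (lc G i) x y = adj G x y (+) [&& x != y, adj G i x & adj G i y].
Proof.
rewrite {1}/adj /= inE cards2 subUset !sub1set !inE -!/(adj _ _ _).
have [<-|_] := eqVneq x y; first by rewrite adjxx.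
by rewrite /=; case: andb; rewrite ?addbT ?addbF.
Qed.

Section Pivot.
Variables (n : nat) (G : graph n) (i j : 'I_n).
Hypothesis ij : adj G i j.

Let ji : adj G j i. Proof. by rewrite adjC. Qed.
Let iNj : i != j. Proof. by apply: contraTneq ij => ->; rewrite adjxx. Qed.
Let jNi : j != i. Proof. by rewrite eq_sym. Qed.

Lemma adj_elc_ends : adj (elc G i j) i j.
Proof. by rewrite !adj_lc !(adjxx, eqxx, ij, ji, iNj, jNi). Qed.

Lemma adj_elc_left k : k != i -> k != j -> adj (elc G i j) i k = adj G j k.
Proof.
rewrite ![k == _]eq_sym => ki kj.
rewrite !adj_lc !(adjxx, eqxx, ij, ji, iNj, jNi, ki, kj) /=.
by do !case: adj.
Qed.

Lemma adj_elc_right k : k != i -> k != j -> adj (elc G i j) j k = adj G i k.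
Proof.
rewrite ![k == _]eq_sym => ki kj.
rewrite !adj_lc !(adjxx, eqxx, ij, ji, iNj, jNi, ki, kj) /=.
by do !case: adj.
Qed.

(** Over F_2 this is the Schur complement of the block on [i] and [j]: that block is the swap
    matrix, which is its own inverse. For [k = l] the two products cancel. *)
Lemma adj_elc_outside k l : k != i -> k != j -> l != i -> l != j ->
  adj (elc G i j) k l =
    adj G k l (+) adj G k i && adj G l j (+) adj G k j && adj G l i.
Proof.
have [<-|kl] := eqVneq k l.
  by rewrite !adjxx => _ _ _ _; do 2!case: adj.
rewrite ![_ == i]eq_sym ![_ == j]eq_sym => ki kj li lj.
rewrite !adj_lc !(adjxx, eqxx, ij, ji, iNj, jNi, ki, kj, li, lj, kl) /=.
rewrite (adjC G k i) (adjC G k j) (adjC G l i) (adjC G l j).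
by do !case: adj.
Qed.

End Pivot.

(* [(exchange X x y, exchange X y x)] is [(x, y)] with the coordinates in [X]
   exchanged. *)
Definition exchange (R : Type) n (X : {set 'I_n}) (x y : 'cV[R]_n) :=
  \col_k (if k \in X then y k ord0 else x k ord0).

(** Coordinates exchanged twice return to their place; this is what lets pivots be composed. *)
Lemma exchange_exchange (R : Type) n (X Y : {set 'I_n}) (x y : 'cV[R]_n) :
  Y \subset X ->
  exchange X (exchange Y x y) (exchange Y y x) = exchange (X :\: Y) x y.
Proof.
move=> /subsetP sYX; apply/matrixP => k l; rewrite !mxE !inE.
by have [kY|_] := boolP (k \in Y); [rewrite (sYX _ kY)|case: ifP].
Qed.

(** The principal pivot transform, stated as a relation on vectors so that neither block inverses
    nor a nonsingular principal submatrix need be mentioned. *)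
Definition pivot_of (R : pzRingType) n (X : {set 'I_n}) (A B : 'M[R]_n) :=
  forall x : 'cV_n, B *m exchange X x (A *m x) = exchange X (A *m x) x.

Lemma pivot_of_set0 (R : pzRingType) n (A B : 'M[R]_n) :
  pivot_of set0 A B -> A = B.
Proof.
have ex0 (x y : 'cV[R]_n) : exchange set0 x y = x.
  by apply/matrixP => k l; rewrite mxE inE /= (ord1 l).
move=> AB; apply/trmx_inj/row_matrixP => k; rewrite -!tr_col !colE.
by have := AB (delta_mx k 0); rewrite !ex0 => ->.
Qed.

Lemma pivot_of_setT (R : comUnitRingType) n (A : 'M[R]_n) :
  A \in unitmx -> pivot_of setT A (invmx A).
Proof.
have exT (x y : 'cV[R]_n) : exchange setT x y = y.
  by apply/matrixP => k l; rewrite mxE inE /= (ord1 l).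
by move=> uA x; rewrite !exT mulKmx.
Qed.

(** Without a neighbour of [i] in [X], the basis vector at [i] is supported in [X] while its image
    vanishes on [X]. The exchange then turns the input of [B] into 0 but leaves a 1 at [i] in the
    output. *)
Lemma pivot_of_adj n (G : graph n) (X : {set 'I_n}) (B : 'M_n) i :
  pivot_of X (adjmx G) B -> i \in X -> exists2 j, j \in X & adj G i j.
Proof.
move=> GB iX; apply/exists_inP; apply: contraT => /exists_inPn noadj.
pose y := adjmx G *m delta_mx i (ord0 : 'I_1).
have yX k : k \in X -> y k ord0 = 0.
  by move=> /noadj kN; rewrite /y -colE mxE adjmxE adjC (negPf kN).
have ex0 : exchange X (delta_mx i ord0) y = 0.
  apply/matrixP => k l; rewrite mxE [RHS]mxE; case: ifPn => [/yX //|kX].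
  by rewrite mxE; case: (eqVneq k i) kX => // ->; rewrite iX.
have /matrixP/(_ i ord0) := GB (delta_mx i ord0).
by rewrite -/y ex0 mulmx0 !mxE iX !eqxx => /eqP.
Qed.

(** The pivot goes from [elc G i j] back to [G], the direction in which it composes with a pivot
    starting at [G]. *)
Lemma pivot_of_elc n (G : graph n) i j :
  adj G i j -> pivot_of [set i; j] (adjmx (elc G i j)) (adjmx G).
Proof.
move=> ij; have ji : adj G j i by rewrite adjC.
have jNi : j != i by apply: contraTneq ij => ->; rewrite adjxx.
have natF2 (a b : bool) : (a (+) b)%:R = a%:R + b%:R :> 'F_2.
  by case: a; case: b; apply/eqP.
have natM (a b : bool) : (a && b)%:R = a%:R * b%:R :> 'F_2.
  by rewrite -natrM mulnb.
have addF2 (a : 'F_2) : a + a = 0 by apply: addrr_pchar2; exact: pchar_Fp.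
move=> u; set A := adjmx G; set B := adjmx _; set v := B *m u.
(* The part of row [k] of [A *m u] due to vertices off the edge, where the exchange leaves [u]
   unchanged. *)
pose S k := \sum_(l | (l != i) && (l != j)) A k l * u l ord0.
have rowE (M : 'M['F_2]_n) (w : 'cV_n) k : (M *m w) k ord0 =
    M k i * w i ord0 + (M k j * w j ord0 +
      \sum_(l | (l != i) && (l != j)) M k l * w l ord0).
  by rewrite mxE (bigD1 i) //= (bigD1 j).
have BC k l : B k l = B l k by rewrite !adjmxE adjC.
have Aii k : A k k = 0 by rewrite adjmxE adjxx.
have Bii k : B k k = 0 by rewrite adjmxE adjxx.
have Bij : B i j = 1 by rewrite adjmxE adj_elc_ends.
have Bi k : k != i -> k != j -> B i k = A j k.
  by move=> ki kj; rewrite !adjmxE adj_elc_left.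
have Bj k : k != i -> k != j -> B j k = A i k.
  by move=> ki kj; rewrite !adjmxE adj_elc_right.
have Aij : A i j = 1 by rewrite adjmxE ij.
have Aji : A j i = 1 by rewrite adjmxE ji.
have vi : v i ord0 = u j ord0 + S j.
  rewrite rowE Bii Bij mul0r mul1r add0r; congr (_ + _).
  by apply: eq_bigr => l /andP[li lj]; rewrite Bi.
have vj : v j ord0 = u i ord0 + S i.
  rewrite rowE Bii BC Bij mul0r mul1r add0r; congr (_ + _).
  by apply: eq_bigr => l /andP[li lj]; rewrite Bj.
have AE k : (A *m exchange [set i; j] u v) k ord0 =
    A k i * v i ord0 + (A k j * v j ord0 + S k).
  have exE l : exchange [set i; j] u v l ord0 =
      if (l == i) || (l == j) then v l ord0 else u l ord0.
    by rewrite mxE !inE.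
  rewrite rowE !exE !eqxx orbT /=; congr (_ + (_ + _)).
  by apply: eq_bigr => l /andP[/negPf li /negPf lj]; rewrite exE li lj.
apply/matrixP => k z; rewrite (ord1 z) AE [RHS]mxE !inE {z}.
have [->|ki] /= := eqVneq k i.
  by rewrite Aii Aij vj mul0r mul1r add0r -addrA addF2 addr0.
have [->|kj] /= := eqVneq k j.
  by rewrite Aii Aji vi mul0r mul1r add0r -addrA addF2 addr0.
(* Summing the rank-two correction of row [k] over the vertices off the edge yields the terms in
   [S j] and [S i]. *)
have -> : v k ord0 = A j k * u i ord0 + (A i k * u j ord0 +
    (S k + A k i * S j + A k j * S i)).
  rewrite rowE BC Bi // [B k j]BC Bj //; congr (_ + (_ + _)).
  rewrite !mulr_sumr -!big_split /=; apply: eq_bigr => l /andP[li lj].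
  rewrite !adjmxE adj_elc_outside // !natF2 !natM (adjC G l j) (adjC G l i).
  by ring.
have AC x y : A x y = A y x by rewrite !adjmxE adjC.
by rewrite vi vj (AC j k) (AC i k); ring.
Qed.

Lemma edge_locally_equivalent_step n (G H : graph n) i j : adj G i j ->
  edge_locally_equivalent (elc G i j) H -> edge_locally_equivalent G H.
Proof. by move=> ij [s sH]; exists ([set i; j] :: s); exists i, j. Qed.

(** Induction on the size of [X]: [B] stays fixed while [G] moves towards it, until nothing is left
    to exchange. *)
Lemma pivot_of_edge_locally_equivalent n (G : graph n) X B :
  pivot_of X (adjmx G) B ->
  exists G', adjmx G' = B /\ edge_locally_equivalent G G'.
Proof.
have [m] := ubnP #|X|; elim: m => // m IHm in G X *.
rewrite ltnS => leXm GB.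
have [X0|[i iX]] := set_0Vmem X.
  by rewrite X0 in GB; exists G; split; [exact: pivot_of_set0|exists [::]].
have [j jX ij] := pivot_of_adj GB iX.
have sX : [set i; j] \subset X by rewrite subUset !sub1set iX.
have [||G' [G'B eG']] := IHm (elc G i j) (X :\: [set i; j]).
- apply: leq_trans leXm; apply: proper_card; apply/properP; split.
    exact: subsetDl.
  by exists i => //; rewrite !inE eqxx.
(* The hypothesis on [B] is applied to the exchanged vector, whose image under [adjmx G] is known
   from [pivot_of_elc]. *)
- move=> u; rewrite -!exchange_exchange //.
  by have := GB (exchange [set i; j] u (adjmx (elc G i j) *m u));
    rewrite pivot_of_elc.
by exists G'; split=> //; apply: edge_locally_equivalent_step eG'.
Qed.

Theorem mainTheorem6 (n : nat) (G : graph n) :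
  adjmx G \in unitmx ->
  exists G' : graph n,
    adjmx G' = invmx (adjmx G) /\ edge_locally_equivalent G G'.
Proof.
move=> uG; apply: (@pivot_of_edge_locally_equivalent _ _ setT).
exact: pivot_of_setT.
Qed.
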